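(* Let $F:\mathbb R^d\to\mathbb R$ be differentiable with gradient $f=\nabla F$ that is $1$-Lipschitz. Let $\mu^*\in\mathbb R^d$, let $\eta_1^*,\dots,\eta_n^*$ be i.i.d. samples from a distribution $D$ on $\mathbb R^d$, and let $y_1,\dots,y_n$ be an $\epsilon$-corruption of $y_i^*=\mu^*+\eta_i^*$. Let $\alpha\in(0,1)$, let $k$ be a positive integer and let $w\in\mathcal W_{2\epsilon}$. Suppose that $\epsilon^{1-\frac1{2k}}\le 0.01\,\alpha$ and $$\alpha\|\hat\mu^w-\mu^*\|^2\le 10\,\langle\nabla\mathcal L^w(\mu^* ),\,\mu^*-\hat\mu^w\rangle.$$ Then $$\|\hat\mu^w-\mu^*\|\le\frac{100}{\alpha}\left(\Big\|\frac1n\sum_{i=1}^n f(\eta_i^* )\Big\|+\epsilon^{1-\frac1{2k}}\big(\hat{\mathfrak m}^w_{2k}+\bar{\mathfrak m}_{2k}\big)\right).$$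
   Context: $y_1,\dots,y_n$ is an $\epsilon$-corruption of $y_1^*,\dots,y_n^*$ if the set $S_g=\{i: y_i=y_i^*\}$ has size at least $(1-\epsilon)n$; $S_b=[n]\setminus S_g$. $\mathcal W_\epsilon=\{w\in\mathbb R^n: 0\le w_i\le 1/n \text{ for all } i,\ \sum_i|w_i-1/n|\le\epsilon\}$. For $w$ with nonnegative entries, $\mathcal L^w(\mu)=\sum_{i=1}^n w_iF(\mu-y_i)$, so $\nabla\mathcal L^w(\mu)=\sum_i w_i f(\mu-y_i)$, and $\hat\mu^w$ is a minimizer of $\mathcal L^w$ over $\mathbb R^d$. Further $$\bar{\mathfrak m}_{2k}=\max_{\|v\|=1}\Big[\frac1n\sum_{i=1}^n\langle f(\eta_i^* ),v\rangle^{2k}\Big]^{\frac1{2k}},\qquad \hat{\mathfrak m}^w_{2k}=\max_{\|v\|=1}\Big[\sum_{i=1}^n w_i\langle f(\hat\mu^w-y_i),v\rangle^{2k}\Big]^{\frac1{2k}}.$$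
   Formalization: As displayed the bound fails when F is not even, as y_i^*=μ^*+η_i^* makes the clean gradients f(−η_i^* ); the formal theorem proves the bound with f(−η_i^* ) in place of f(η_i^* ) (also in the moment m̄_{2k}) for all F, and the displayed bound when F is even. *)

(* Defs.v *)
From HB Require Import structures.
From mathcomp Require Import all_boot all_order all_algebra.
From mathcomp Require Import all_classical all_reals all_analysis.

Set Implicit Arguments.
Unset Strict Implicit.
Unset Printing Implicit Defensive.

Import Order.TTheory GRing.Theory Num.Theory.
Import numFieldNormedType.Exports.

Local Open Scope classical_set_scope.
Local Open Scope ring_scope.

(* The library norm `|x| on 'rV[R]_d is the sup norm, so the Euclidean
   structure of R^d is given by [dotp] and [enorm]. *)
Definition dotp (R : realType) (d : nat) (u v : 'rV[R]_d) : R :=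
  \sum_(j < d) u 0 j * v 0 j.

Definition enorm (R : realType) (d : nat) (u : 'rV[R]_d) : R :=
  Num.sqrt (dotp u u).

Definition gradient (R : realType) (d : nat) (G : 'rV[R]_d -> R)
    (x : 'rV[R]_d) : 'rV[R]_d :=
  \row_(j < d) 'D_(delta_mx 0 j) G x.

Definition borelV (R : realType) (d : nat) :=
  g_sigma_algebraType (@open 'rV[R]_d).

Definition iid_samples (R : realType) (d n : nat) (disp : measure_display)
    (Omega : measurableType disp) (P : probability Omega R)
    (D : probability (borelV R d) R) (X : 'I_n -> Omega -> borelV R d) : Prop :=
  [/\ forall i, measurable_fun [set: Omega] (X i),
      forall i (B : set (borelV R d)), measurable B -> P (X i @^-1` B) = D B
    & forall (J : {set 'I_n}) (B : 'I_n -> set (borelV R d)),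
        (forall i, measurable (B i)) ->
        P (\bigcap_(i in [set` J]) (X i @^-1` B i)) =
        (\prod_(i in J) P (X i @^-1` B i))%E].

Definition corruption (R : realType) (d n : nat) (eps : R)
    (ystar y : 'I_n -> 'rV[R]_d) : Prop :=
  (1 - eps) * n%:R <= #|[pred i | y i == ystar i]|%:R.

Definition weights (R : realType) (n : nat) (eps : R) (w : 'I_n -> R) : Prop :=
  (forall i, 0 <= w i <= n%:R^-1) /\ \sum_(i < n) `|w i - n%:R^-1| <= eps.

Definition loss (R : realType) (d n : nat) (F : 'rV[R]_d -> R)
    (y : 'I_n -> 'rV[R]_d) (w : 'I_n -> R) (mu : 'rV[R]_d) : R :=
  \sum_(i < n) w i * F (mu - y i).

Definition minimizer (R : realType) (d : nat) (G : 'rV[R]_d -> R)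
    (x : 'rV[R]_d) : Prop :=
  forall z, G x <= G z.

(* max over ||v|| = 1 of (sum_i w_i <x_i, v>^(2k))^(1/(2k)). The supremum is
   attained, the unit sphere being compact (and it is 0 when d = 0). *)
Definition max_moment (R : realType) (d n : nat) (k : nat) (w : 'I_n -> R)
    (x : 'I_n -> 'rV[R]_d) : R :=
  sup [set (\sum_(i < n) w i * dotp (x i) v ^+ (2 * k)) `^ ((2 * k)%:R^-1)
      | v in [set v : 'rV[R]_d | enorm v = 1]].

(* Main.v *)
(** Test the growth hypothesis along the unit vector [u] from [muhat] to
    [mustar].  With [B] the corrupted indices, [\sum_i w_i <f(mustar - y_i), u>]
    is the clean mean [<1/n \sum_i f(- eta_i), u>], minus
    [\sum_i c_i <f(- eta_i), u>] with weights [0 <= c_i <= 1/n] of total mass at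
    most [3 eps], plus [\sum_(i in B) w_i <f(mustar - y_i), u>].  Hoelder's
    inequality bounds a sum of mass [O(eps)] by [O(eps^(1 - 1/2k))] times the
    directional [2k]-th moment; on [B], replacing [mustar] by [muhat] costs at
    most [eps ||muhat - mustar||], which is absorbed by the left-hand side since
    [eps <= eps^(1 - 1/2k) <= alpha / 100]. *)

Require Import Defs.
From HB Require Import structures.
From mathcomp Require Import all_boot all_order all_algebra.
From mathcomp Require Import all_classical all_reals all_analysis.
From mathcomp Require Import ring lra.

Set Implicit Arguments.
Unset Strict Implicit.
Unset Printing Implicit Defensive.

Import Order.TTheory GRing.Theory Num.Theory.
Import numFieldNormedType.Exports.

Local Open Scope classical_set_scope.
Local Open Scope ring_scope.

(** * Euclidean inner product and norm *)

Lemma dotpDl (R : realType) (d : nat) (u v x : 'rV[R]_d) :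
  dotp (u + v) x = dotp u x + dotp v x.
Proof.
by rewrite -big_split; apply: eq_bigr => j _; rewrite mxE mulrDl.
Qed.

Lemma dotpC (R : realType) (d : nat) (u v : 'rV[R]_d) : dotp u v = dotp v u.
Proof. by apply: eq_bigr => j _; rewrite mulrC. Qed.

Lemma dotpZl (R : realType) (d : nat) (a : R) (u v : 'rV[R]_d) :
  dotp (a *: u) v = a * dotp u v.
Proof. by rewrite mulr_sumr; apply: eq_bigr => j _; rewrite mxE mulrA. Qed.

Lemma dotpZr (R : realType) (d : nat) (a : R) (u v : 'rV[R]_d) :
  dotp u (a *: v) = a * dotp u v.
Proof. by rewrite dotpC dotpZl dotpC. Qed.

Lemma dotpNl (R : realType) (d : nat) (u v : 'rV[R]_d) :
  dotp (- u) v = - dotp u v.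
Proof. by rewrite -scaleN1r dotpZl mulN1r. Qed.

Lemma dotpNr (R : realType) (d : nat) (u v : 'rV[R]_d) :
  dotp u (- v) = - dotp u v.
Proof. by rewrite dotpC dotpNl dotpC. Qed.

Lemma dotp_suml (R : realType) (d n : nat) (x : 'I_n -> 'rV[R]_d)
    (v : 'rV[R]_d) :
  dotp (\sum_(i < n) x i) v = \sum_(i < n) dotp (x i) v.
Proof.
rewrite /dotp exchange_big; apply: eq_bigr => j _.
by rewrite summxE mulr_suml.
Qed.

Lemma dotp_ge0 (R : realType) (d : nat) (u : 'rV[R]_d) : 0 <= dotp u u.
Proof. by apply: sumr_ge0 => j _; rewrite -expr2 sqr_ge0. Qed.

Lemma enorm_ge0 (R : realType) (d : nat) (u : 'rV[R]_d) : 0 <= enorm u.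
Proof. exact: sqrtr_ge0. Qed.

Lemma sqr_enorm (R : realType) (d : nat) (u : 'rV[R]_d) :
  enorm u ^+ 2 = dotp u u.
Proof. by rewrite sqr_sqrtr ?dotp_ge0. Qed.

Lemma enormN (R : realType) (d : nat) (u : 'rV[R]_d) : enorm (- u) = enorm u.
Proof. by rewrite /enorm dotpNl dotpNr opprK. Qed.

(** Cauchy-Schwarz: the part of [x] orthogonal to [v] has nonnegative squared norm. *)
Lemma dotp_unit_le (R : realType) (d : nat) (x v : 'rV[R]_d) :
  enorm v = 1 -> `|dotp x v| <= enorm x.
Proof.
move=> v1; have vv : dotp v v = 1 by rewrite -sqr_enorm v1 expr1n.
rewrite -sqrtr_sqr ler_sqrt ?dotp_ge0//.
have := dotp_ge0 (x - dotp x v *: v).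
rewrite dotpDl dotpNl dotpZl (dotpC x) (dotpC v (_ - _)) !dotpDl !dotpNl.
by rewrite !dotpZl (dotpC v x) vv; lra.
Qed.

(** * Weighted Hoelder inequality through tangent lines *)

(** Convexity of powers. In the induction, multiplying by [a] leaves the surplus
    [q.+1%:R * m ^+ q * (a - m) ^+ 2]. *)
Lemma tangent_expr_le (R : realType) (q : nat) (a m : R) :
  0 <= a -> 0 <= m ->
  m ^+ q.+1 + q.+1%:R * m ^+ q * (a - m) <= a ^+ q.+1.
Proof.
move=> a0 m0; elim: q => [|q IH]; first by rewrite !expr1 expr0; lra.
rewrite [a ^+ _]exprS; apply: le_trans (ler_wpM2l a0 IH).
rewrite -subr_ge0 [leRHS](_ : _ = q.+1%:R * m ^+ q * (a - m) ^+ 2).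
  by rewrite mulr_ge0 ?sqr_ge0// mulr_ge0 ?exprn_ge0.
by rewrite -[q.+2%:R]natr1 !(exprS m); ring.
Qed.

Lemma expr_even_normr (R : realType) (k : nat) (a : R) :
  `|a| ^+ (2 * k) = a ^+ (2 * k).
Proof. by rewrite !exprM real_normK ?num_real. Qed.

(* Jensen's inequality for [|.|^(2k)]: sum the tangent line inequality at the
   weighted mean [m] of the [|a i|]. *)
Lemma hoelder_weighted_sum (R : realType) (n k : nat) (c a : 'I_n -> R) :
  (0 < k)%N -> (forall i, 0 <= c i) ->
  \sum_(i < n) c i * a i <=
  (\sum_(i < n) c i) `^ (1 - (2 * k)%:R^-1) *
  (\sum_(i < n) c i * a i ^+ (2 * k)) `^ ((2 * k)%:R^-1).
Proof.
move=> k0 c0; set p := (2 * k)%N.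
have p0 : (0 < p)%N by rewrite muln_gt0.
set S := \sum_(i < n) c i.
have S0 : 0 <= S by apply: sumr_ge0.
have [/eqP SE|Sneq0] := boolP (S == 0).
  rewrite big1 ?mulr_ge0 ?powR_ge0// => i _.
  by rewrite (psumr_eq0P (fun i _ => c0 i) SE)// mul0r.
set T := \sum_(i < n) c i * `|a i|.
have T0 : 0 <= T by apply: sumr_ge0 => i _; rewrite mulr_ge0.
set m := T / S.
have m0 : 0 <= m by rewrite divr_ge0.
have TE : T = S * m by rewrite /m mulrCA divff ?mulr1.
(* The first-order terms cancel because [m] is the [c]-weighted mean of the [|a i|]. *)
have tangent : S * m ^+ p <= \sum_(i < n) c i * a i ^+ p.
  rewrite [leLHS](_ : _ =
      \sum_(i < n) c i * (m ^+ p + p%:R * m ^+ p.-1 * (`|a i| - m))).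
    apply: ler_sum => i _; apply: ler_wpM2l => //.
    by rewrite -(expr_even_normr k (a i)) -/p -(prednK p0) tangent_expr_le.
  under eq_bigr do rewrite mulrDr mulrBr mulrDr mulrCA mulrN (mulrCA (c _)).
  rewrite !big_split/= -!mulr_suml -/S sumrN -!mulr_sumr -/T -!mulr_suml -/S.
  by rewrite TE; ring.
apply: (@le_trans _ _ T).
  by apply: ler_sum => i _; apply: ler_wpM2l => //; rewrite ler_norm.
have -> : T = S `^ (1 - p%:R^-1) * (S * m ^+ p) `^ (p%:R^-1).
  rewrite powRM ?exprn_ge0// mulrA -powRD ?Sneq0 ?implybT//.
  rewrite subrK powRr1// -powR_mulrn// -powRrM divff ?powRr1//.
  by rewrite pnatr_eq0 -lt0n.
apply: ler_wpM2l; first exact: powR_ge0.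
apply: ge0_ler_powR; rewrite ?invr_ge0 ?nnegrE ?mulr_ge0 ?exprn_ge0//.
by apply: sumr_ge0 => i _; rewrite mulr_ge0// /p exprM exprn_ge0 ?sqr_ge0.
Qed.

(** * Directional moments *)

Lemma le_max_moment (R : realType) (d n k : nat) (w : 'I_n -> R)
    (x : 'I_n -> 'rV[R]_d) (v : 'rV[R]_d) :
  (forall i, 0 <= w i) -> enorm v = 1 ->
  (\sum_(i < n) w i * dotp (x i) v ^+ (2 * k)) `^ ((2 * k)%:R^-1) <=
  max_moment k w x.
Proof.
move=> w0 v1; apply: ub_le_sup; last by exists v.
(* Bounding by [sup] requires a bounded set; Cauchy-Schwarz gives a bound uniform in the
   direction. *)
exists ((\sum_(i < n) w i * enorm (x i) ^+ (2 * k)) `^ ((2 * k)%:R^-1)).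
move=> _ [u /= u1 <-].
apply: ge0_ler_powR; rewrite ?invr_ge0 ?nnegrE//.
- by apply: sumr_ge0 => i _; rewrite mulr_ge0// exprM exprn_ge0 ?sqr_ge0.
- by apply: sumr_ge0 => i _; rewrite mulr_ge0// exprn_ge0 ?enorm_ge0.
- apply: ler_sum => i _; apply: ler_wpM2l => //.
  rewrite -expr_even_normr lerXn2r ?nnegrE ?enorm_ge0//.
  exact: dotp_unit_le.
Qed.

Lemma max_moment_ge0 (R : realType) (d n k : nat) (w : 'I_n -> R)
    (x : 'I_n -> 'rV[R]_d) :
  (forall i, 0 <= w i) -> 0 <= max_moment k w x.
Proof.
move=> w0.
have [[v v1]|noV] := pselect (exists v : 'rV[R]_d, enorm v = 1).
  by apply: le_trans (le_max_moment k x w0 v1); exact: powR_ge0.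
(* Without unit vectors ([d = 0]) the supremum is that of the empty set, which is 0. *)
rewrite /max_moment [X in image X _](_ : _ = set0) ?image_set0 ?sup0//.
by rewrite -subset0 => v v1; apply: noV; exists v.
Qed.

Lemma max_momentN (R : realType) (d n k : nat) (w : 'I_n -> R)
    (x : 'I_n -> 'rV[R]_d) :
  max_moment k w (fun i => - x i) = max_moment k w x.
Proof.
congr sup; apply: eq_imagel => v _; congr powR.
by apply: eq_bigr => i _; rewrite dotpNl -expr_even_normr normrN expr_even_normr.
Qed.

(** Hoelder with the weights [c]; then the mass grows to [s] and, even powers being nonnegative, the
    weights in the moment grow to [w]. *)
Lemma weighted_dotp_le_max_moment (R : realType) (d n k : nat) (s : R)
    (c w : 'I_n -> R) (x : 'I_n -> 'rV[R]_d) (v : 'rV[R]_d) :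
  (0 < k)%N -> (forall i, 0 <= c i <= w i) -> \sum_(i < n) c i <= s ->
  enorm v = 1 ->
  \sum_(i < n) c i * dotp (x i) v <=
  s `^ (1 - (2 * k)%:R^-1) * max_moment k w x.
Proof.
move=> k0 cw cs v1.
have c0 i : 0 <= c i by case/andP: (cw i).
have w0 i : 0 <= w i by case/andP: (cw i) => /le_trans; exact.
have S0 : 0 <= \sum_(i < n) c i by apply: sumr_ge0.
apply: (le_trans (hoelder_weighted_sum (fun i => dotp (x i) v) k0 c0)).
apply: ler_pM; rewrite ?powR_ge0//.
  apply: ge0_ler_powR; rewrite ?nnegrE ?(le_trans S0 cs)//.
  by rewrite subr_ge0 invf_le1 ?ltr0n ?ler1n ?muln_gt0.
apply: le_trans (le_max_moment k x w0 v1).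
have e0 i : 0 <= dotp (x i) v ^+ (2 * k) by rewrite exprM exprn_ge0 ?sqr_ge0.
apply: ge0_ler_powR; rewrite ?invr_ge0 ?nnegrE//.
- by apply: sumr_ge0 => i _; rewrite mulr_ge0.
- by apply: sumr_ge0 => i _; rewrite mulr_ge0.
- by apply: ler_sum => i _; apply: ler_wpM2r => //; case/andP: (cw i).
Qed.

(** * Weighted sums under corruption *)

(** Meant for [h i = f (mustar - y i)], [g i = f (- eta i)], [z i = f (muhat - y i)] and
    [t = enorm (muhat - mustar)]. *)
Lemma weighted_corrupted_sum_le (R : realType) (d n k : nat) (eps t : R)
    (w : 'I_n -> R) (B : pred 'I_n) (g h z : 'I_n -> 'rV[R]_d) (u : 'rV[R]_d) :
  (0 < k)%N -> 0 <= eps -> weights (2 * eps) w ->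
  #|B|%:R <= eps * n%:R -> enorm u = 1 -> 0 <= t ->
  (forall i, ~~ B i -> h i = g i) ->
  (forall i, enorm (h i - z i) <= t) ->
  dotp (\sum_(i < n) w i *: h i) u <=
  enorm (n%:R^-1 *: \sum_(i < n) g i) +
  eps `^ (1 - (2 * k)%:R^-1) *
    (max_moment k w z + 3 * max_moment k (fun=> n%:R^-1) g) + eps * t.
Proof.
move=> k0 eps0 [w01 wsum] Bcard u1 t0 hg hz.
have w0 i : 0 <= w i by case/andP: (w01 i).
have wn i : w i <= n%:R^-1 by case/andP: (w01 i).
have nV0 : 0 <= n%:R^-1 :> R by rewrite invr_ge0.
(* Chosen so that [w i = n%:R^-1 - c i + b i] at every index. *)
pose b i := if B i then w i else 0.
pose c i := if B i then n%:R^-1 else n%:R^-1 - w i.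
have Bmass : \sum_(i < n) (if B i then n%:R^-1 else 0) <= eps :> R.
  rewrite -big_mkcond/= sumr_const -[_ *+ #|_|]mulr_natl.
  apply: (le_trans (ler_wpM2r nV0 Bcard)); rewrite -mulrA.
  have [->|n0] := eqVneq (n%:R : R) 0; first by rewrite mul0r mulr0.
  by rewrite divff ?mulr1.
have bmass : \sum_(i < n) b i <= eps.
  by apply: le_trans Bmass; apply: ler_sum => i _; rewrite /b; case: ifP.
(* One [eps] is the uniform mass of [B], the other two bound the distance of [w] from the uniform
   weights. *)
have cmass : \sum_(i < n) c i <= 3 * eps.
  have -> : 3 * eps = eps + 2 * eps by ring.
  apply: le_trans (lerD Bmass wsum); rewrite -big_split/=.
  apply: ler_sum => i _; rewrite /c distrC; case: ifP => _.
    by rewrite lerDl.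
  by rewrite add0r ler_norm.
(* Testing against [- u] absorbs the sign of the [c]-sum, so its weights stay nonnegative; on [B],
   [h] is split as [z + (h - z)]. *)
have decomp : dotp (\sum_(i < n) w i *: h i) u =
    dotp (n%:R^-1 *: \sum_(i < n) g i) u +
    \sum_(i < n) c i * dotp (g i) (- u) +
    \sum_(i < n) b i * dotp (z i) u +
    \sum_(i < n) b i * dotp (h i - z i) u.
  rewrite dotpZl !dotp_suml mulr_sumr -!big_split/=.
  apply: eq_bigr => i _; rewrite dotpZl dotpNr dotpDl dotpNl /b /c.
  by case: ifP => Bi; [ring | rewrite hg ?Bi//; ring].
have mean : dotp (n%:R^-1 *: \sum_(i < n) g i) u <=
    enorm (n%:R^-1 *: \sum_(i < n) g i).
  exact: le_trans (ler_norm _) (dotp_unit_le _ u1).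
have good : \sum_(i < n) c i * dotp (g i) (- u) <=
    (3 * eps) `^ (1 - (2 * k)%:R^-1) * max_moment k (fun=> n%:R^-1) g.
  apply: weighted_dotp_le_max_moment; rewrite ?enormN// => i.
  by rewrite /c; case: ifP => _; have := w0 i; have := wn i; lra.
have bad : \sum_(i < n) b i * dotp (z i) u <=
    eps `^ (1 - (2 * k)%:R^-1) * max_moment k w z.
  apply: weighted_dotp_le_max_moment => // i.
  by rewrite /b; case: ifP => _; rewrite ?w0 ?lexx.
have lip : \sum_(i < n) b i * dotp (h i - z i) u <= eps * t.
  apply: le_trans (ler_wpM2r t0 bmass); rewrite mulr_suml.
  apply: ler_sum => i _; apply: ler_wpM2l; first by rewrite /b; case: ifP.
  exact: le_trans (ler_norm _) (le_trans (dotp_unit_le _ u1) (hz i)).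
have three : (3 * eps) `^ (1 - (2 * k)%:R^-1) <=
    3 * eps `^ (1 - (2 * k)%:R^-1).
  rewrite powRM//; apply: ler_wpM2r; first exact: powR_ge0.
  by apply: ler1_powR; [rewrite ler1n | rewrite gerBl invr_ge0 ler0n].
have {}good := le_trans good
  (ler_wpM2r (max_moment_ge0 k g (fun=> nV0)) three).
rewrite decomp; apply: le_trans (lerD (lerD (lerD mean good) bad) lip) _.
move: (enorm _) (eps `^ _) (max_moment k w z) (max_moment k _ g) => N E M1 M2.
by clear; lra.
Qed.

(** * Gradients of the loss and of even functions *)

Lemma gradient_loss (R : realType) (d n : nat) (F : 'rV[R]_d -> R)
    (y : 'I_n -> 'rV[R]_d) (w : 'I_n -> R) (mu : 'rV[R]_d) :
  (forall x, differentiable F x) ->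
  gradient (loss F y w) mu = \sum_(i < n) w i *: gradient F (mu - y i).
Proof.
move=> dF; apply/rowP => j; rewrite mxE summxE.
pose Fs i x := F (x - y i).
(* Both sides yield the same difference quotient, so the derivative of the translate at [mu] is that
   of [F] at [mu - y i]. *)
have FsE i : Fs i \o shift mu = F \o shift (mu - y i).
  by apply/funext => x; rewrite /Fs /= addrA.
have dFs i : is_derive mu (delta_mx 0 j) (Fs i)
    ('D_(delta_mx 0 j) F (mu - y i)).
  split; last by rewrite /derive FsE.
  by rewrite /derivable FsE; exact: diff_derivable.
have -> : loss F y w = \sum_(i < n) (w i \*: Fs i).
  by apply/funext => x; rewrite /loss fct_sumE.
rewrite derive_val; apply: eq_bigr => i _.
by rewrite !mxE.
Qed.

(** Chain rule applied to [F \o (- id) = F]. *)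
Lemma gradient_even (R : realType) (d : nat) (F : 'rV[R]_d -> R)
    (x : 'rV[R]_d) :
  (forall x, differentiable F x) -> (forall x, F (- x) = F x) ->
  gradient F (- x) = - gradient F x.
Proof.
move=> dF Feven; apply/rowP => j; rewrite !mxE.
have FN : F \o (- id) = F by apply/funext => z; exact: Feven.
have dN : is_diff x (- id : 'rV[R]_d -> 'rV[R]_d) (- id) by exact: is_diffN.
have dFN : is_diff ((- id) x) F ('d F (- x)) by exact/differentiableP.
have dFx : is_diff x F ('d F (- x) \o - id).
  by rewrite -[X in is_diff _ X _]FN; exact: is_diff_comp.
rewrite !deriveE// [in RHS](@diff_val _ _ _ _ _ _ _ dFx) /= !fctE.
by rewrite raddfN opprK.
Qed.

(** * Absorption and the final bound *)

(** The term [10 * eps * e] is at most a tenth of [alpha * e]. Absorbing it leaves constants 10/0.9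
    and 30/0.9, both below 100. *)
Lemma le_of_self_bound (R : realType) (alpha e s N E M1 M2 eps : R) :
  0 < alpha -> 0 <= e -> 0 <= N -> 0 <= E -> 0 <= M1 -> 0 <= M2 ->
  eps <= 100^-1 * alpha -> alpha * e <= 10 * s ->
  s <= N + E * (M1 + 3 * M2) + eps * e ->
  e <= 100 / alpha * (N + E * (M1 + M2)).
Proof.
move=> a0 e0 N0 E0 M10 M20 /(ler_wpM2r e0) epse key main.
have EM1 : 0 <= E * M1 by rewrite mulr_ge0.
have EM2 : 0 <= E * M2 by rewrite mulr_ge0.
by rewrite mulrAC ler_pdivlMr//; lra.
Qed.

(** The deterministic core, for one realization [eta] of the noise. The argument is [- eta i]
    because [mustar - y i = - eta i] on clean indices. *)
Lemma corrupted_gradient_bound (R : realType) (d n : nat)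
    (F : 'rV[R]_d -> R) (f : 'rV[R]_d -> 'rV[R]_d) (mustar : 'rV[R]_d)
    (eta y : 'I_n -> 'rV[R]_d) (eps alpha : R) (k : nat) (w : 'I_n -> R)
    (muhat : 'rV[R]_d) :
  (forall x, differentiable F x) -> f = gradient F ->
  (forall x z, enorm (f x - f z) <= enorm (x - z)) ->
  corruption eps (fun i => mustar + eta i) y ->
  0 < alpha < 1 -> (0 < k)%N -> weights (2 * eps) w ->
  eps `^ (1 - (2 * k)%:R^-1) <= 100^-1 * alpha ->
  alpha * enorm (muhat - mustar) ^+ 2 <=
    10 * dotp (gradient (loss F y w) mustar) (mustar - muhat) ->
  enorm (muhat - mustar) <=
  100 / alpha *
    (enorm (n%:R^-1 *: \sum_(i < n) f (- eta i)) +
     eps `^ (1 - (2 * k)%:R^-1) *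
       (max_moment k w (fun i => f (muhat - y i)) +
        max_moment k (fun=> n%:R^-1) (fun i => f (- eta i)))).
Proof.
move=> dF -> lip corr /andP[a0 a1] k0 wW epsE growth.
have eps0 : 0 <= eps.
  have : 0 <= 2 * eps by apply: le_trans wW.2; apply: sumr_ge0.
  by lra.
have w0 i : 0 <= w i by case/andP: (wW.1 i).
have q0 : 0 < (2 * k)%:R^-1 :> R by rewrite invr_gt0 ltr0n muln_gt0.
have q1 : (2 * k)%:R^-1 <= 1 :> R.
  by rewrite invf_le1 ?ltr0n ?ler1n ?muln_gt0.
(* This needs [eps <= 1]: for larger [eps] the power would be at least 1, against the bound by
   [alpha / 100]. *)
have eps_le : eps <= eps `^ (1 - (2 * k)%:R^-1).
  have [->|epsneq0] := eqVneq eps 0; first exact: powR_ge0.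
  have [eps1|eps1] := leP eps 1.
    apply: ger1_powR; first by rewrite lt0r epsneq0 eps0 eps1.
    by rewrite gerBl ltW.
  have : eps `^ 0 <= eps `^ (1 - (2 * k)%:R^-1).
    by apply: ler_powR; rewrite ?subr_ge0 ?(ltW eps1).
  rewrite powRr0 => /le_trans/(_ epsE) absurd.
  by exfalso; move: absurd a1; clear; lra.
pose e := enorm (muhat - mustar).
have eE : enorm (mustar - muhat) = e by rewrite -enormN opprB.
have close (s : R) : alpha * e <= 10 * s ->
    s <= enorm (n%:R^-1 *: \sum_(i < n) gradient F (- eta i)) +
      eps `^ (1 - (2 * k)%:R^-1) *
        (max_moment k w (fun i => gradient F (muhat - y i)) +
         3 * max_moment k (fun=> n%:R^-1) (fun i => gradient F (- eta i))) +
      eps * e ->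
    e <= 100 / alpha *
      (enorm (n%:R^-1 *: \sum_(i < n) gradient F (- eta i)) +
       eps `^ (1 - (2 * k)%:R^-1) *
         (max_moment k w (fun i => gradient F (muhat - y i)) +
          max_moment k (fun=> n%:R^-1) (fun i => gradient F (- eta i)))).
  apply: le_of_self_bound; rewrite ?enorm_ge0 ?powR_ge0 ?max_moment_ge0//.
  exact: le_trans epsE.
(* If [e = 0] there is no direction to normalize, and [s = 0] serves. *)
have [e_eq0|eneq0] := eqVneq e 0.
  apply: (close 0); rewrite e_eq0 !mulr0// addr0.
  rewrite addr_ge0 ?enorm_ge0// mulr_ge0 ?powR_ge0//.
  by rewrite addr_ge0 ?max_moment_ge0// mulr_ge0 ?max_moment_ge0.
have e0 : 0 < e by rewrite lt0r eneq0 enorm_ge0.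
pose u := e^-1 *: (mustar - muhat).
have u1 : enorm u = 1.
  rewrite /enorm dotpZl dotpZr mulrA -sqr_enorm eE -expr2 -exprMn mulVf//.
  by rewrite expr1n sqrtr1.
apply: (close (dotp (\sum_(i < n) w i *: gradient F (mustar - y i)) u)).
  (* Multiplying by [e] turns the goal back into the growth hypothesis. *)
  rewrite -(ler_pM2r e0) /u dotpZr -mulrA -expr2 -mulrA mulrAC mulVf// mul1r.
  by rewrite -gradient_loss.
apply: (@weighted_corrupted_sum_le _ _ _ _ _ _ _
  [pred i | y i != mustar + eta i]) => //.
- have := cardC [pred i | y i == mustar + eta i].
  rewrite card_ord => /(congr1 (fun m => m%:R : R)); rewrite natrD => cardE.
  move: corr; rewrite /corruption mulrBl mul1r -cardE lerBlDr lerD2l.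
  exact.
- exact: ltW.
- by move=> i /=; rewrite negbK => /eqP ->; rewrite opprD addrA subrr add0r.
- by move=> i; apply: le_trans (lip _ _) _; rewrite opprB addrA subrK eE.
Qed.

Theorem theorem4p1 (R : realType) (d n : nat)
  (F : 'rV[R]_d -> R) (f : 'rV[R]_d -> 'rV[R]_d)
  (F_diff : forall x, differentiable F x)
  (f_grad : f = gradient F)
  (f_lip : forall x z, enorm (f x - f z) <= enorm (x - z))
  (mustar : 'rV[R]_d)
  (disp : measure_display) (Omega : measurableType disp)
  (P : probability Omega R) (D : probability (borelV R d) R)
  (eta : 'I_n -> Omega -> 'rV[R]_d)
  (eta_iid : iid_samples P D eta)
  (omega : Omega)
  (eps : R) (y : 'I_n -> 'rV[R]_d)
  (y_corr : corruption eps (fun i => mustar + eta i omega) y)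
  (alpha : R) (alpha01 : 0 < alpha < 1)
  (k : nat) (k_gt0 : (0 < k)%N)
  (w : 'I_n -> R) (wW : weights (2 * eps) w)
  (muhat : 'rV[R]_d) (muhat_min : minimizer (loss F y w) muhat)
  (eps_small : eps `^ (1 - (2 * k)%:R^-1) <= 100^-1 * alpha)
  (growth : alpha * enorm (muhat - mustar) ^+ 2 <=
            10 * dotp (gradient (loss F y w) mustar) (mustar - muhat)) :
  let bound (x : 'I_n -> 'rV[R]_d) :=
    enorm (muhat - mustar) <=
    100 / alpha *
      (enorm (n%:R^-1 *: \sum_(i < n) f (x i)) +
       eps `^ (1 - (2 * k)%:R^-1) *
         (max_moment k w (fun i => f (muhat - y i)) +
          max_moment k (fun=> n%:R^-1) (fun i => f (x i)))) in
  bound (fun i => - eta i omega) /\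
  ((forall x, F (- x) = F x) -> bound (fun i => eta i omega)).
Proof.
have bound := corrupted_gradient_bound F_diff f_grad f_lip y_corr alpha01 k_gt0
  wW eps_small growth.
split; first exact: bound.
move=> Feven.
(* For even [F] the gradient is odd, and neither the norm nor the even moments see the sign. *)
have fN : (fun i => f (- eta i omega)) = (fun i => - f (eta i omega)).
  by apply/funext => i; rewrite f_grad gradient_even.
move: bound; rewrite fN max_momentN.
under eq_bigr do rewrite f_grad gradient_even// -f_grad.
by rewrite sumrN scalerN enormN.
Qed.
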